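(* There exists a Banach space $X$ such that $X^*$ is separable, $\mathrm{Sz}(X)=\omega^2$, and the Kalton graph $([\mathbb{N}]^{<\omega},d_{\mathbb{K}})$ Lipschitz embeds into $X^*$.
   Context: $\mathbb{N}=\{1,2,\dots\}$ and $[\mathbb{N}]^{<\omega}$ is the set of all finite subsets of $\mathbb{N}$ (including $\emptyset$), equipped with the metric $$d_{\mathbb{K}}(\overline n,\overline m)=\sup\big\{\big||\overline n\cap S|-|\overline m\cap S|\big| : S\text{ a segment (interval of consecutive integers) of }\mathbb{N}\big\}.$$ (For each $k$, its restriction to the set $[\mathbb{N}]^k$ of $k$-element subsets is the shortest path metric of the graph in which distinct $\overline n,\overline m$ are adjacent iff $n_1\le m_1\le n_2\le\dots\le n_k\le m_k$ or $m_1\le n_1\le m_2\le\dots\le m_k\le n_k$.) A map $f:(M,d_M)\to(N,d_N)$ is a Lipschitz embedding if there are $A,B>0$ with $A\,d_M(x,y)\le d_N(f(x),f(y))\le B\,d_M(x,y)$ for all $x,y\in M$. Szlenk index: for a weak$^*$ compact $K\subset X^*$ and $\varepsilon>0$, let $s_\varepsilon(K)=K\setminus\bigcup\{V\subset X^*: V\text{ weak}^*\text{ open and }\mathrm{diam}(V\cap K)<\varepsilon\}$. Define inductively $s_\varepsilon^0(K)=s_\varepsilon(K)$, $s_\varepsilon^{\xi+1}(K)=s_\varepsilon(s_\varepsilon^\xi(K))$, and $s_\varepsilon^\xi(K)=\bigcap_{\zeta<\xi}s_\varepsilon^\zeta(K)$ for limit ordinals $\xi$. $\mathrm{Sz}(X,\varepsilon)$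 is the least ordinal $\xi$ with $s_\varepsilon^\xi(B_{X^*})=\emptyset$ if it exists, and $\infty$ otherwise, and $\mathrm{Sz}(X)=\sup_{\varepsilon>0}\mathrm{Sz}(X,\varepsilon)$. $\omega$ is the first infinite ordinal. *)

(* Defs.v *)
From HB Require Import structures.
From mathcomp Require Import all_boot all_order all_algebra finmap.
From mathcomp Require Import all_classical all_reals all_analysis.

Set Implicit Arguments.
Unset Strict Implicit.
Unset Printing Implicit Defensive.

Import Order.TTheory GRing.Theory Num.Theory.
Import numFieldNormedType.Exports.
Local Open Scope classical_set_scope.
Local Open Scope ring_scope.

Section dual.
Context {R : realType} (X : normedModType R).

Definition dual_pred : {pred X -> R} :=
  fun f => `[< scalar f /\ continuous f >].

Record dual := Dual { dual_fun :> X -> R; dual_funP : dual_fun \in dual_pred }.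

HB.instance Definition _ := [isSub for dual_fun].
HB.instance Definition _ := [Choice of dual by <:].

Fact dual_submod_closed : submod_closed dual_pred.
Proof.
split; first by apply/asboolP; split=> [a x y|] /=; [
  rewrite /GRing.zero/= mulr0 addr0|exact: cst_continuous].
move=> a f g /asboolP[lf cf] /asboolP[lg cg]; apply/asboolP; split.
  move=> b x y; rewrite !fctE lf lg !scalerDr addrACA mulrDr; congr (_ + _ + _).
  exact: mulrCA.
move=> x; apply: (@continuousD R R^o); last exact: cg.
by apply: (@continuousZr R R^o); exact: cf.
Qed.

HB.instance Definition _ :=
  GRing.isSubmodClosed.Build R (X -> R) dual_pred dual_submod_closed.
HB.instance Definition _ := [SubChoice_isSubLmodule of dual by <:].

Definition dual_norm (f : dual) : R :=
  sup [set `|f x| | x in [set x : X | `|x| <= 1]].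

Let pack_linear (f : X -> R) (lf : scalar f) : {linear X -> R^o} :=
  HB.pack f (GRing.isLinear.Build _ _ _ _ f lf).

Lemma dual_bounded (f : dual) :
  has_sup [set `|f x| | x in [set x : X | `|x| <= 1]].
Proof.
split; first by exists `|f 0|; exists 0 => //=; rewrite normr0.
have /asboolP[lf cf] := dual_funP f.
have : bounded_near (pack_linear lf) (nbhs (0 : X)).
  exact/linear_bounded_continuous.
move/linear_boundedP/pinfty_ex_gt0 => [M M0 fM].
exists M => _ [x x1 <-]; rewrite (le_trans (fM x))//.
by rewrite ler_piMr// ltW.
Qed.

Lemma le_dual_norm (f : dual) (x : X) : `|x| <= 1 -> `|f x| <= dual_norm f.
Proof. by move=> x1; apply: (ub_le_sup (dual_bounded f).2); exists x. Qed.

Lemma dual_norm_le (f : dual) (M : R) :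
  (forall x, `|x| <= 1 -> `|f x| <= M) -> dual_norm f <= M.
Proof. by move=> fM; apply: ge_sup (dual_bounded f).1 _ => _ [x /fM + <-]. Qed.

Lemma dual_normD (f g : dual) : dual_norm (f + g) <= dual_norm f + dual_norm g.
Proof.
apply: dual_norm_le => x x1; rewrite (le_trans (ler_normD _ _))//.
by rewrite lerD ?le_dual_norm.
Qed.

Let dual_normZ_le (a : R) (f : dual) : dual_norm (a *: f) <= `|a| * dual_norm f.
Proof.
apply: dual_norm_le => x x1; rewrite normrM.
by rewrite ler_wpM2l ?le_dual_norm.
Qed.

Lemma dual_normZ (a : R) (f : dual) : dual_norm (a *: f) = `|a| * dual_norm f.
Proof.
apply/eqP; rewrite eq_le dual_normZ_le/=.
have [->|a0] := eqVneq a 0.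
  by rewrite normr0 mul0r (le_trans _ (@le_dual_norm _ 0 _))// normr0.
rewrite -ler_pdivlMl ?normr_gt0// -normfV.
by rewrite -[leLHS](_ : dual_norm (a^-1 *: (a *: f)) = _) ?dual_normZ_le//
  scalerA mulVf// scale1r.
Qed.

Lemma dual_norm0_eq0 (f : dual) : dual_norm f = 0 -> f = 0.
Proof.
move=> f0; apply/val_inj/funext => x /=; rewrite [RHS]/GRing.zero/=.
have /asboolP[lf _] := dual_funP f.
have [->|x0] := eqVneq x 0; first exact: (linear0 (pack_linear lf)).
have nx0 : 0 < `|x|^-1 by rewrite invr_gt0 normr_gt0.
have : `|f (`|x|^-1 *: x)| <= dual_norm f.
  by apply: le_dual_norm; rewrite normrZ gtr0_norm// mulVf// normr_eq0.
have -> : f (`|x|^-1 *: x) = `|x|^-1 * f x.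
  exact: (linearZ_LR (pack_linear lf)).
by rewrite f0 normr_le0 mulf_eq0 gt_eqF//= => /eqP.
Qed.

HB.instance Definition _ :=
  Lmodule_isNormed.Build R dual dual_normD dual_normZ dual_norm0_eq0.

Definition weak_star : Type :=
  initial_topology (fun f : dual => dual_fun f : {ptws X -> R}).

HB.instance Definition _ := Topological.on weak_star.

End dual.

Definition separable (T : topologicalType) : Prop :=
  exists2 D : set T, countable D & dense D.

Section ordinals.

(* Ordinals, presented as well-founded trees: [osup f] is the least ordinal
   strictly greater than every [f i].  Distinct trees may denote the same
   ordinal, so equality of ordinals is [oeq]. *)
Inductive Ord : Type := osup (J : Type) (f : J -> Ord).

Fixpoint ole (a b : Ord) : Prop :=
  let: osup J f := a in
  let: osup L g := b in forall j, exists l, ole (f j) (g l).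

Definition oeq (a b : Ord) : Prop := ole a b /\ ole b a.
Definition ozero : Ord := osup (fun i : void => match i with end).
Definition osucc (a : Ord) : Ord := osup (fun _ : unit => a).
Definition olt (a b : Ord) : Prop := ole (osucc a) b.
Definition olimit (a : Ord) : Prop :=
  ~ oeq a ozero /\ forall b, ~ oeq a (osucc b).

(* a + omega = sup_k (a + k) *)
Definition oplus_omega (a : Ord) : Ord := osup (fun k : nat => iter k osucc a).
(* omega ^ 2 = sup_n (omega * n) *)
Definition omega2 : Ord := osup (fun n : nat => iter n oplus_omega ozero).

Lemma ole_refl a : ole a a.
Proof. by elim: a => J f IH /= j; exists j. Qed.

Lemma ole_trans b a c : ole a b -> ole b c -> ole a c.
Proof.
elim: a b c => J f IH [L g] [M h] /= ab bc j.
by have [l /IH fg] := ab j; have [m /fg] := bc l; exists m.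
Qed.

Lemma olt_osup a J (f : J -> Ord) : olt a (osup f) <-> exists j, ole a (f j).
Proof. by split=> [/(_ tt)//|af []]. Qed.

Lemma oltW a b : olt a b -> ole a b.
Proof.
elim: a b => J f IH [L g] /olt_osup[l fg] /= j; exists l.
by apply: IH; apply: ole_trans fg; apply/olt_osup; exists j; exact: ole_refl.
Qed.

Lemma olt_child J (f : J -> Ord) j : olt (f j) (osup f).
Proof. by apply/olt_osup; exists j; exact: ole_refl. Qed.

Lemma ole_lt_trans b a c : ole a b -> olt b c -> olt a c.
Proof. by case: c => J f ab /olt_osup[j bj]; apply/olt_osup; exists j; exact: ole_trans bj. Qed.

Lemma olt_le_trans b a c : olt a b -> ole b c -> olt a c.
Proof. exact: ole_trans. Qed.

Lemma olt_ind (P : Ord -> Prop) :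
  (forall a, (forall b, olt b a -> P b) -> P a) -> forall a, P a.
Proof.
move=> IH a; suff: forall b, ole b a -> P b by apply; exact: ole_refl.
elim: a => J f IHf b bf; apply: IH => c cb.
by have /olt_osup[j /IHf] := olt_le_trans cb bf.
Qed.

Lemma oltNge a b : olt a b <-> ~ ole b a.
Proof.
split.
  elim/olt_ind: a b => a IH [L g] /olt_osup[l al] ba.
  have ga : olt (g l) a by apply: olt_le_trans ba; exact: olt_child.
  exact: (IH _ ga a).
elim: b a => J f IH [L g] /existsNP[j /forallNP fg].
have {fg IH} : forall l, olt (g l) (f j) by move=> l; exact/IH.
move=> gf; apply/olt_osup; exists j.
by case: (f j) gf => M h gh l; exact: (gh l tt).
Qed.

(* Ordinal-indexed iteration of [s] starting from [s K] at index zero.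
   [osup f] is zero when it has no child, the successor of [f j] when [f j] is
   a greatest child, and otherwise a limit in which the children are cofinal;
   [derived0], [derivedS] and [derived_lim] give the recursion equations. *)
Fixpoint derived T (s : set T -> set T) (K : set T) (a : Ord) : set T :=
  let: osup J f := a in [set x |
    [/\ (J -> False) -> s K x,
        forall j, (forall i, ole (f i) (f j)) -> s (derived s K (f j)) x &
        (forall j, exists i, olt (f j) (f i)) ->
          forall j, derived s K (f j) x]].

Section derived_theory.
Context {T : Type} (s : set T -> set T) (K : set T).
Context (s_sub : forall A, s A `<=` A).

Lemma derived_anti a b : ole a b -> derived s K b `<=` derived s K a.
Proof.
elim/olt_ind: b a => -[L g] IH a ab x /= [gx0 gxS gxl].
have gl_lt l := @olt_child L g l.
have [L0|/existsNP[l0 _]] := pselect (L -> False).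
  case: a ab => J f ab; split=> [_|j|_ j]; first exact: gx0.
  - by have [k _] := ab j; case: (L0 k).
  - by have [k _] := ab j; case: (L0 k).
have gx l : derived s K (g l) x.
  have [|/existsNP[m /forallNP gm]] :=
    pselect (forall j, exists i, olt (g j) (g i)); first by move/gxl; exact.
  have {}gm i : ole (g i) (g m) by apply: contrapT => /oltNge/gm.
  by apply: (IH (g m)) (gm l) _ _ => //; exact: s_sub (gxS _ gm).
have [[l al]|/forallNP nal] := pselect (exists l, ole a (g l)).
  exact: (IH (g l)) al _ (gx l).
case: a ab nal => J f ab nal.
have gf l : olt (g l) (osup f) by apply/oltNge.
split.
- by move=> J0; have /olt_osup[k _] := gf l0; case: (J0 k).
- move=> j fj; have [l jl] := ab j.
  have lj i : ole (g i) (f j).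
    by have /olt_osup[k gk] := gf i; exact: ole_trans gk (fj k).
  have := gxS l (fun i => ole_trans (lj i) jl).
  rewrite (_ : derived s K (g l) = derived s K (f j))//; apply/seteqP; split.
    exact: IH.
  by apply: IH (lj l); exact: ole_lt_trans jl _.
- by move=> _ j; have [l jl] := ab j; exact: (IH (g l)) jl _ (gx l).
Qed.

Lemma derived_oeq a b : oeq a b -> derived s K a = derived s K b.
Proof. by move=> [ab ba]; apply/seteqP; split; exact: derived_anti. Qed.

Lemma derived0 : derived s K ozero = s K.
Proof.
by apply/seteqP; split=> [x [+ _ _]|x sx]; [exact|split=> // -[]].
Qed.

Lemma derivedS a : derived s K (osucc a) = s (derived s K a).
Proof.
apply/seteqP; split=> x.
  by move=> [_ /(_ tt) + _]; apply=> _; exact: ole_refl.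
move=> sx; split=> [/(_ tt)//|//|/(_ tt)[_ /oltNge]].
by move/(_ (ole_refl _)).
Qed.

Lemma derived_lim a : olimit a ->
  derived s K a = [set x | forall b, olt b a -> derived s K b x].
Proof.
move=> [a0 aS]; apply/seteqP; split=> x.
  by move=> ax b /oltW ba; exact: derived_anti ba _ ax.
case: a a0 aS => J f f0 fS fx; split.
- by move=> J0; case: f0; split=> [j|[]]; have := J0 j.
- move=> j fj; case: (fS (f j)); split; last exact: olt_child.
  by move=> i /=; exists tt.
- by move=> _ j; apply: fx; exact: olt_child.
Qed.

End derived_theory.
End ordinals.

Section szlenk.
Context {R : realType} (X : normedModType R).

Definition diam (A : set (dual X)) : \bar R :=
  ereal_sup [set `|f - g|%:E | f in A & g in A].

Definition szlenk_derivation (eps : R) (K : set (dual X)) : set (dual X) :=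
  K `\` \bigcup_(V in [set V : set (weak_star X) |
                        open V /\ (diam (V `&` K) < eps%:E)%E]) V.

Lemma szlenk_derivation_sub eps (K : set (dual X)) :
  szlenk_derivation eps K `<=` K.
Proof. exact: subDsetl. Qed.

Definition dual_ball : set (dual X) := [set f | `|f| <= 1].

Definition szlenk_derived (eps : R) : Ord -> set (dual X) :=
  derived (szlenk_derivation eps) dual_ball.

(* Sz(X, eps) = a; no ordinal satisfies this when Sz(X, eps) is infinite *)
Definition is_Sz_eps (eps : R) (a : Ord) : Prop :=
  szlenk_derived eps a = set0 /\
  forall b, szlenk_derived eps b = set0 -> ole a b.

(* Sz(X) = a, that is, a is the supremum of the Sz(X, eps) *)
Definition is_Sz (a : Ord) : Prop :=
  (forall eps, 0 < eps -> exists2 b, is_Sz_eps eps b & ole b a) /\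
  (forall c, (forall eps b, 0 < eps -> is_Sz_eps eps b -> ole b c) -> ole a c).

End szlenk.

Section kalton.

(* intervals of consecutive integers of {1, 2, ...} *)
Definition segment (S : set nat) : Prop :=
  (forall i, S i -> (0 < i)%N) /\
  (forall i j k, S i -> S k -> (i <= j <= k)%N -> S j).

(* the finite subsets of {1, 2, ...} *)
Definition kalton : Type := {n : {fset nat} | 0%N \notin n}.

Definition card_in (n : kalton) (S : set nat) : nat :=
  #|` [fset i in val n | i \in S]%fset|.

Definition dK (R : realType) (n m : kalton) : R :=
  sup [set `|(card_in n S)%:R - (card_in m S)%:R| | S in segment].

Lemma has_sup_dK (R : realType) (n m : kalton) :
  has_sup [set `|(card_in n S)%:R - (card_in m S)%:R : R| | S in segment].
Proof.
split; first by eexists; exists set0.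
exists (#|` val n|%:R + #|` val m|%:R) => _ [S _ <-].
rewrite (le_trans (ler_normB _ _))// !normr_nat lerD// ler_nat.
  by apply: fsubset_leq_card; exact: fset_sub.
by apply: fsubset_leq_card; exact: fset_sub.
Qed.

End kalton.

Definition lipschitz_embedding (R : realType) (M N : Type)
    (dM : M -> M -> R) (dN : N -> N -> R) (f : M -> N) : Prop :=
  exists A B : R, [/\ 0 < A, 0 < B &
    forall x y, A * dM x y <= dN (f x) (f y) <= B * dM x y].

(* Main.v *)
Require Import Defs.
From HB Require Import structures.
From mathcomp Require Import all_boot all_order all_algebra finmap lra ring zify.
From mathcomp Require Import all_classical all_reals all_analysis.
Set Implicit Arguments.
Unset Strict Implicit.
Unset Printing Implicit Defensive.
Import Order.TTheory GRing.Theory Num.Theory.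
Import numFieldNormedType.Exports.
Local Open Scope classical_set_scope.
Local Open Scope ring_scope.

(** Let Y_k be the space l_1 renormed by
      sup_q (|b_0 + ... + b_(q-1)| + (|b_0| + ... + |b_(q-1)|) / (k + 1)),
    and let Y be the l_1-sum of the Y_k.  Its elements are arrays a k i, and its
    norm is the supremum of the seminorms [rho N q].  The space X is the predual
    of Y spanned by the coordinates: the closure, in the bounded functions on
    the unit ball of Y, of the linear combinations of the functions a |-> a k i.
    A functional on X is determined by its array of values at the coordinates
    ([entries_inj]), every array of finite norm occurs ([entries_ex]), and the
    norms agree ([rho_entries_le], [norm_dual_le]), so X^* is Y.

    The summing part of the norm makes the Kalton graph embed.  If n and m are
    sets with at most k + 1 elements, the difference of their indicators on
    level k has prefix sums bounded by dK n m, while its l_1 part, divided by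
    k + 1, is at most 2.  So each level embeds the sets of bounded size with a
    constant that does not depend on the bound.  To treat all sizes at once, n is
    sent to its indicator spread over the levels k with |n| <= k < 2 |n|, each
    with weight 1 / |n|.  The weights add up to 1, hence summing over the levels
    recovers the prefix counts of n, which gives the lower estimate; and they
    move by O(1 / |n|) when |n| moves by one, which gives the upper estimate
    ([rho_spread]).

    The l_1 part of the norm keeps Y a separable dual and controls the Szlenk
    index.  Each level is isomorphic to l_1 and the levels are added in l_1, so
    the mass of an array concentrates on a finite box ([rho_concentrates]), and
    rational arrays on boxes are dense.  If the sets of a decreasing sequence of
    derivations lie in the ball of radius r, then near a point of norm larger
    than r - eps / 8 the norm is carried by finitely many levels, where it is an
    l_1-norm up to a constant; each derivation then lowers this l_1-norm by a
    fixed amount, and the neighbourhood dies after finitely many steps.  Hence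
    omega derivations lower the radius by eps / 8 ([szlenk_omega_drop]), and the
    index of the ball is at most omega * n for some n depending on eps.
    Conversely, on level k one can add k + 1 successive pulses (+1, -1), each
    of them as far away as desired, with a sum of norm at most 3.  Since far
    pulses are weak* close to zero, any finite number of derivations, with eps = d / 3,
    leaves the ball of radius r - d alive inside the ball of radius r
    ([szlenk_omega_stay]).  So no omega * n bounds the index for every eps. *)

(** * The norm of arrays *)

Section array_norm.
Context {R : realType}.
Implicit Types (b : nat -> R) (a : nat -> nat -> R).

Definition levnorm (k q : nat) b : R :=
  `|\sum_(i < q) b i| + k.+1%:R^-1 * \sum_(i < q) `|b i|.

(** The cut-off on level k is [q k]: the norm of Y is the supremum over all N and
    q, and each of these seminorms depends on finitely many entries only. *)
Definition rho (N : nat) (q : nat -> nat) a : R := \sum_(k < N) levnorm k (q k) (a k).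

Definition l1norm (N n : nat) a : R := \sum_(k < N) \sum_(i < n) `|a k i|.

Lemma levnorm_ge0 k q b : 0 <= levnorm k q b.
Proof. by rewrite addr_ge0// mulr_ge0 ?invr_ge0// sumr_ge0. Qed.

Lemma levnormD k q b b' : levnorm k q (b + b') <= levnorm k q b + levnorm k q b'.
Proof.
rewrite /levnorm addrACA -mulrDr -big_split/= lerD//.
  by rewrite big_split/= ler_normD.
by rewrite ler_wpM2l ?invr_ge0// ler_sum// => i _; rewrite ler_normD.
Qed.

Lemma levnormZ k q (c : R) b : levnorm k q (c *: b) = `|c| * levnorm k q b.
Proof.
rewrite /levnorm mulrDr mulrCA -normrM !mulr_sumr.
by congr (_ + _); apply: eq_bigr => i _; rewrite -?normrM// !mulr_sumr normrM.
Qed.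

Lemma levnormN k q b : levnorm k q (- b) = levnorm k q b.
Proof. by rewrite -scaleN1r [LHS]levnormZ normrN1 mul1r. Qed.

Lemma levnormB k q b b' : levnorm k q (b - b') <= levnorm k q b + levnorm k q b'.
Proof. by rewrite (le_trans (levnormD _ _ _ _))// levnormN. Qed.

Lemma levnorm_le_l1 k q b : levnorm k q b <= 2 * \sum_(i < q) `|b i|.
Proof.
rewrite mulr_natl mulr2n lerD ?ler_norm_sum//.
by rewrite ler_piMl ?sumr_ge0// invf_le1// ler1n.
Qed.

Lemma le_sum_ord (F : nat -> R) m n : (forall i, 0 <= F i) -> (m <= n)%N ->
  \sum_(i < m) F i <= \sum_(i < n) F i.
Proof.
move=> F0 mn; rewrite -!(big_mkord xpredT) (big_cat_nat _ mn)//=.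
by rewrite lerDl sumr_ge0.
Qed.

Lemma rho_ge0 N q a : 0 <= rho N q a.
Proof. by apply: sumr_ge0 => k _; exact: levnorm_ge0. Qed.

Lemma rhoZ N q (c : R) a : rho N q (c *: a) = `|c| * rho N q a.
Proof. by rewrite mulr_sumr; apply: eq_bigr => k _; exact: levnormZ. Qed.

Lemma rhoN N q a : rho N q (- a) = rho N q a.
Proof. by apply: eq_bigr => k _; exact: levnormN. Qed.

Lemma rho0 N q : rho N q 0 = 0.
Proof. by rewrite -(scale0r 0) rhoZ normr0 mul0r. Qed.

Lemma l1norm_ge0 N n a : 0 <= l1norm N n a.
Proof. by do 2!(apply: sumr_ge0 => ? _). Qed.

Lemma l1norm_le_rho N n a : l1norm N n a <= N%:R * rho N (fun=> n) a.
Proof.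
rewrite mulr_sumr; apply: ler_sum => k _.
rewrite /levnorm mulrDr ler_wpDl ?mulr_ge0//.
rewrite mulrA ler_peMl ?sumr_ge0// ler_pdivlMr// mul1r ler_nat.
exact: ltn_ord.
Qed.

Lemma entry_le_rho k i a : `|a k i| <= k.+1%:R * rho k.+1 (fun=> i.+1) a.
Proof.
apply: le_trans (l1norm_le_rho _ _ _); rewrite /l1norm big_ord_recr/=.
rewrite [in leRHS]big_ord_recr/= addrA ler_wpDl//.
by apply: addr_ge0; do ?(apply: sumr_ge0 => ? _).
Qed.

Definition tail_le N (d : R) a : Prop :=
  forall N' (q : nat -> nat), \sum_(N <= k < N') levnorm k (q k) (a k) <= d.

(** The levels are added in l_1: a seminorm that almost attains the bound r on
    the first N levels leaves at most d for the remaining ones, since the two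
    families of cut-offs can be glued at level N. *)
Lemma tail_of_rho (r d : R) N q a : (forall N' q', rho N' q' a <= r) ->
  r - d <= rho N q a -> tail_le N d a.
Proof.
move=> ar rd N' q'.
have [N'N|NN'] := leqP N' N.
  by rewrite big_geq//; move: (le_trans rd (ar _ _)); lra.
have := ar N' (fun k => if (k < N)%N then q k else q' k).
rewrite /rho -(big_mkord xpredT (fun k =>
  levnorm k (if (k < N)%N then q k else q' k) (a k))).
rewrite (big_cat_nat _ (ltnW NN'))//=.
rewrite [X in X + _](_ : _ = rho N q a); last first.
  by rewrite big_mkord; apply: eq_bigr => k _; rewrite ltn_ord.
rewrite [X in _ + X](_ : _ = \sum_(N <= k < N') levnorm k (q' k) (a k)).
  by move: rd; lra.
by apply: eq_big_nat => k /andP[Nk _]; rewrite ltnNge Nk.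
Qed.

(** On each single level the norm is at most twice the l_1-norm, so a small l_1
    mass on the first levels and a small tail bound the whole norm. *)
Lemma rho_split_le N N' q a (d e : R) : tail_le N d a ->
  (forall n', l1norm N n' a <= e) -> rho N' q a <= 2 * e + d.
Proof.
move=> ad ae.
have -> : rho N' q a <= 2 * e + d =
  (\sum_(0 <= k < N') levnorm k (q k) (a k) <= 2 * e + d) by rewrite big_mkord.
apply: (@le_trans _ _ (\sum_(0 <= k < maxn N N') levnorm k (q k) (a k))).
  rewrite !big_mkord; apply: (@le_sum_ord (fun k => levnorm k (q k) (a k))).
    by move=> k; exact: levnorm_ge0.
  exact: leq_maxr.
rewrite (big_cat_nat _ (leq_maxl N N'))//= lerD//.
rewrite big_mkord; set n' := \max_(k < N) q k.
apply: le_trans (_ : 2 * l1norm N n' a <= _); last by rewrite ler_pM2l.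
rewrite mulr_sumr; apply: ler_sum => k _.
apply: le_trans (levnorm_le_l1 _ _ _) _; rewrite ler_pM2l//.
by apply: (@le_sum_ord (fun i => `|a k i|)) => //; exact: leq_bigmax.
Qed.

End array_norm.

(** * Concentration of arrays on boxes *)

Section box_estimates.
Context {R : realType}.
Implicit Types (a b : nat -> nat -> R).

Lemma le_l1norm N n n' a : (n <= n')%N -> l1norm N n a <= l1norm N n' a.
Proof.
by move=> nn'; apply: ler_sum => k _; exact: (@le_sum_ord _ (fun i => `|a k i|)).
Qed.

Lemma l1normD N n a b : l1norm N n (a + b) <= l1norm N n a + l1norm N n b.
Proof.
rewrite -big_split ler_sum// => k _; rewrite -big_split ler_sum// => i _.
exact: ler_normD.
Qed.

Lemma l1normN N n a : l1norm N n (- a) = l1norm N n a.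
Proof. by apply: eq_bigr => k _; apply: eq_bigr => i _; exact: normrN. Qed.

Lemma tail_leB N (d d' : R) a b :
  tail_le N d a -> tail_le N d' b -> tail_le N (d + d') (a - b).
Proof.
move=> ad bd N' q; apply: le_trans (lerD (ad N' q) (bd N' q)).
by rewrite -big_split ler_sum// => k _; exact: levnormB.
Qed.

(** Two arrays that are concentrated on the same box are close as soon as they
    are close on that box. *)
Lemma l1norm_boxB N n (d e e' : R) a b :
  (forall n', l1norm N n' a <= l1norm N n a + e) ->
  (forall n', l1norm N n' b <= l1norm N n b + e') ->
  l1norm N n (a - b) <= d ->
  forall n', l1norm N n' (a - b) <= d + e + e'.
Proof.
move=> ae be abd n'.
apply: (le_trans (le_l1norm _ _ (leq_maxr n n'))); set m := maxn n n'.
have outE c : l1norm N m c =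
    l1norm N n c + \sum_(k < N) \sum_(n <= i < m) `|c k i|.
  rewrite -big_split; apply: eq_bigr => k _ /=.
  rewrite -!(big_mkord xpredT (fun i => `|c k i|)).
  exact: big_cat_nat (leq_maxl _ _).
have := ae m; have := be m; rewrite !outE.
have : \sum_(k < N) \sum_(n <= i < m) `|(a - b) k i| <=
    \sum_(k < N) \sum_(n <= i < m) `|a k i| +
    \sum_(k < N) \sum_(n <= i < m) `|b k i|.
  rewrite -big_split ler_sum// => k _; rewrite -big_split ler_sum// => i _.
  exact: ler_normB.
by move: abd; lra.
Qed.

Lemma rho_boxB N n (d d' e e' h : R) a b :
  tail_le N d a -> tail_le N d' b ->
  (forall n', l1norm N n' a <= l1norm N n a + e) ->
  (forall n', l1norm N n' b <= l1norm N n b + e') ->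
  l1norm N n (a - b) <= h ->
  forall N' q, rho N' q (a - b) <= 2 * (h + e + e') + (d + d').
Proof.
move=> ad bd ae be abh N' q; apply: (@rho_split_le _ N).
  exact: tail_leB.
exact: l1norm_boxB.
Qed.

(** Both the level norms and, on finitely many levels, the entries are summable,
    so partial sums close to the suprema leave little outside. *)
Lemma rho_concentrates a (M e : R) : 0 < e -> (forall N q, rho N q a <= M) ->
  exists N n, tail_le N e a /\ (forall n', l1norm N n' a <= l1norm N n a + e).
Proof.
move=> e0 aM.
pose S := [set rho N.1 N.2 a | N in [set: nat * (nat -> nat)]].
have supS : has_sup S.
  by split; [exists (rho 0 id a), (0%N, id)|exists M => _ [N _ <-]].
have [_ [[N q] _ <-] Nq] := sup_adherent e0 supS.
have tN : tail_le N e a.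
  apply: tail_of_rho (ltW Nq) => N' q'.
  by apply: (ub_le_sup supS.2); exists (N', q').
pose T := [set l1norm N n a | n in [set: nat]].
have supT : has_sup T.
  split; first by exists (l1norm N 0 a), 0%N.
  exists (N%:R * M) => _ [n _ <-].
  by rewrite (le_trans (l1norm_le_rho _ _ _))// ler_wpM2l.
have [_ [n _ <-] nT] := sup_adherent e0 supT.
exists N, n; split=> // n'; rewrite -lerBlDr (le_trans _ (ltW nT))//.
by rewrite lerD2r; apply: (ub_le_sup supT.2); exists n'.
Qed.

End box_estimates.

(** * The Banach space *)

Section predual.
Context {R : realType}.

Record array_ball := ArrayBall
  { ball_fun :> nat -> nat -> R; ballP : forall N q, rho N q ball_fun <= 1 }.
Implicit Types (g : array_ball) (s : seq (R * (nat * nat))).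

Definition comb s g : R := \sum_(w <- s) w.1 * g w.2.1 w.2.2.

(** The uniform closure of the span of the coordinates.  The functions are taken
    on the whole unit ball of Y, arrays of infinite support included, so that
    evaluation at any element of the ball is directly a functional. *)
Definition predual_pred : {pred array_ball -> R} :=
  fun x => `[< forall e, 0 < e -> exists s, forall g, `|x g - comb s g| <= e >].

Record predual :=
  Predual { predual_fun :> array_ball -> R; predual_funP : predual_fun \in predual_pred }.

HB.instance Definition _ := [isSub for predual_fun].
HB.instance Definition _ := [Choice of predual by <:].

Fact predual_submod_closed : submod_closed predual_pred.
Proof.
split.
  apply/asboolP => e e0; exists [::] => g.
  by rewrite /comb big_nil subr0 normr0 ltW.
move=> c x y /asboolP xP /asboolP yP; apply/asboolP => e e0.
have c0 : 0 < `|c| + 1 by rewrite ltr_wpDl.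
have [s sx] := xP (e / 2 / (`|c| + 1)) ltac:(by rewrite !divr_gt0).
have [t ty] := yP (e / 2) ltac:(by rewrite divr_gt0).
exists ([seq (c * w.1, w.2) | w <- s] ++ t) => g.
rewrite /comb big_cat big_map/= -/(comb t g).
have -> : \sum_(w <- s) c * w.1 * g w.2.1 w.2.2 = c * comb s g.
  by rewrite mulr_sumr; apply: eq_bigr => w _; rewrite mulrA.
have -> : (c *: x + y) g - (c * comb s g + comb t g) =
  c * (x g - comb s g) + (y g - comb t g).
  by rewrite !fctE [c *: x g]/(c * x g) mulrBr opprD addrACA.
rewrite (le_trans (ler_normD _ _))// (splitr e) lerD// normrM.
apply: le_trans (_ : (`|c| + 1) * (e / 2 / (`|c| + 1)) <= _).
  by rewrite ler_pM// lerDl.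
by rewrite mulrC divfK// gt_eqF.
Qed.

HB.instance Definition _ :=
  GRing.isSubmodClosed.Build R (array_ball -> R) predual_pred predual_submod_closed.
HB.instance Definition _ := [SubChoice_isSubLmodule of predual by <:].

Lemma entry_ball k i g : `|g k i| <= k.+1%:R.
Proof. by rewrite (le_trans (entry_le_rho _ _ _))// ler_piMr// ballP. Qed.

Lemma ball0P N q : rho N q (0 : nat -> nat -> R) <= 1.
Proof. by rewrite rho0. Qed.
Definition ball0 : array_ball := ArrayBall ball0P.

Definition predual_norm (x : predual) : R := sup [set `|x g| | g in [set: array_ball]].

Lemma predual_bounded (x : predual) : has_sup [set `|x g| | g in [set: array_ball]].
Proof.
split; first by exists `|x ball0|; exists ball0.
have /asboolP/(_ 1 ltr01)[s sx] := predual_funP x.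
exists (1 + \sum_(w <- s) `|w.1| * w.2.1.+1%:R) => _ [g _ <-].
rewrite -[x g](subrK (comb s g)) (le_trans (ler_normD _ _))// lerD//.
rewrite (le_trans (ler_norm_sum _ _ _))// ler_sum// => w _.
by rewrite normrM ler_wpM2l// entry_ball.
Qed.

Lemma le_predual_norm (x : predual) g : `|x g| <= predual_norm x.
Proof. by apply: (ub_le_sup (predual_bounded x).2); exists g. Qed.

Lemma predual_norm_le (x : predual) (M : R) :
  (forall g, `|x g| <= M) -> predual_norm x <= M.
Proof. by move=> xM; apply: ge_sup (predual_bounded x).1 _ => _ [g _ <-]. Qed.

Lemma predual_normD (x y : predual) :
  predual_norm (x + y) <= predual_norm x + predual_norm y.
Proof.
apply: predual_norm_le => g.
by rewrite (le_trans (ler_normD _ _))// lerD ?le_predual_norm.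
Qed.

Lemma predual_normZ (c : R) (x : predual) :
  predual_norm (c *: x) = `|c| * predual_norm x.
Proof.
have le c' x' : predual_norm (c' *: x') <= `|c'| * predual_norm x'.
  by apply: predual_norm_le => g; rewrite normrM ler_wpM2l ?le_predual_norm.
apply/eqP; rewrite eq_le le/=.
have [->|c0] := eqVneq c 0.
  by rewrite normr0 mul0r (le_trans _ (@le_predual_norm _ ball0)).
rewrite -ler_pdivlMl ?normr_gt0// -normfV.
by rewrite (le_trans _ (le _ _))// scalerA mulVf// scale1r.
Qed.

Lemma predual_norm0_eq0 (x : predual) : predual_norm x = 0 -> x = 0.
Proof.
move=> x0; apply/val_inj/funext => g /=; apply/eqP; rewrite -normr_le0.
by rewrite (le_trans (le_predual_norm x g))// x0.
Qed.

HB.instance Definition _ := Lmodule_isNormed.Build R predual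
  predual_normD predual_normZ predual_norm0_eq0.

Lemma le_norm_predual (x : predual) g : `|x g| <= `|x|.
Proof. exact: le_predual_norm. Qed.

Lemma norm_predual_le (x : predual) (M : R) : (forall g, `|x g| <= M) -> `|x| <= M.
Proof. exact: predual_norm_le. Qed.

(** A uniform limit of functions in the closure is again in the closure, and the
    pointwise limits of a Cauchy filter are uniform. *)
Lemma predual_complete (F : set_system predual) :
  ProperFilter F -> cauchy F -> cvg F.
Proof.
move=> FF /cauchy_ballP Fc.
have Fsmall e : 0 < e -> exists2 A, F A &
    forall x y g, A x -> A y -> `|x g - y g| < e.
  move=> e0; have [[A B] /= [FA FB] AB] := Fc e e0.
  exists (A `&` B); first exact: filterI.
  move=> x y g [Ax _] [_ By]; have := AB (x, y) (conj Ax By).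
  by rewrite -ball_normE /ball_/=; apply: le_lt_trans; exact: (le_norm_predual (x - y)).
have ev_cvg g : cvg ((fun x : predual => x g) @ F).
  apply: cauchy_cvg; apply/cauchy_exP => e e0; have [A FA Ae] := Fsmall e e0.
  have [x Ax] := filter_ex FA; exists (x g).
  apply: (@filterS _ F _ A) => // y Ay.
  by rewrite -ball_normE /ball_/= Ae.
pose l g : R := lim ((fun x : predual => x g) @ F).
have Fl e : 0 < e -> exists2 A, F A & forall x g, A x -> `|x g - l g| <= e.
  move=> e0; have [A FA Ae] := Fsmall e e0; exists A => // x g Ax.
  rewrite ler_distlC; apply/andP; split.
    apply: (limr_ge (ev_cvg g)); apply: (@filterS _ F _ A) => // y Ay.
    by have := Ae _ _ g Ax Ay; rewrite ltr_norml => /andP[]; lra.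
  apply: (limr_le (ev_cvg g)); apply: (@filterS _ F _ A) => // y Ay.
  by have := Ae _ _ g Ax Ay; rewrite ltr_norml => /andP[]; lra.
have lP : l \in predual_pred.
  apply/asboolP => e e0.
  have [A FA Ae] := Fl (e / 2) ltac:(by rewrite divr_gt0).
  have [x Ax] := filter_ex FA.
  have /asboolP/(_ (e / 2) ltac:(by rewrite divr_gt0))[s sx] := predual_funP x.
  exists s => g; have := sx g; have := Ae x g Ax.
  by rewrite !ler_norml => /andP[? ?] /andP[? ?]; apply/andP; split; lra.
apply/cvg_ex; exists (Predual lP); apply/cvgrPdist_le => e e0.
have [A FA Ae] := Fl e e0; apply: (@filterS _ F _ A) => // x Ax.
by rewrite distrC; apply: norm_predual_le => g; exact: Ae.
Qed.

HB.instance Definition _ := Uniform_isComplete.Build predual predual_complete.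

End predual.

(** * Functionals on a normed space *)

Section dual_functionals.
Context {R : realType} (X : normedModType R).
Implicit Types (f : dual X).

Fact dual_scalar f : scalar f.
Proof. by have /asboolP[] := dual_funP f. Qed.

HB.instance Definition _ f :=
  GRing.isLinear.Build R X R *%R (dual_fun f) (dual_scalar f).

Lemma dual_norm_bound f x : `|f x| <= `|f| * `|x|.
Proof.
have [->|x0] := eqVneq x 0; first by rewrite linear0 !normr0 mulr0.
have nx0 : 0 < `|x| by rewrite normr_gt0.
rewrite -ler_pdivrMr// -[X in _ / X]gtr0_norm// -normf_div mulrC -linearZ.
by apply: le_dual_norm; rewrite normrZ gtr0_norm ?invr_gt0// mulVf// gt_eqF.
Qed.

Lemma dualDE f f' x : (f + f') x = f x + f' x. Proof. by []. Qed.

Lemma bounded_scalar_dual (h : X -> R) (M : R) : scalar h ->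
  (forall x, `|h x| <= M * `|x|) -> h \in @dual_pred R X.
Proof.
move=> hl hM; apply/asboolP; split=> //.
pose l : {linear X -> R^o} := HB.pack h (GRing.isLinear.Build _ _ _ _ h hl).
apply: (@linear_bounded_continuous _ _ _ l).1.
apply/linear_boundedP; exists M; split; first exact: num_real.
by move=> r /ltW Mr x; rewrite (le_trans (hM x))// ler_wpM2r.
Qed.

End dual_functionals.

(** * The dual as a space of arrays *)

Section duality.
Context {R : realType}.
Notation X := (@predual R).
Implicit Types (a : nat -> nat -> R) (f : dual X).

Fact unit_vec_subproof k i : (fun g : array_ball => g k i) \in @predual_pred R.
Proof.
apply/asboolP => e e0; exists [:: (1, (k, i))] => g.
by rewrite /comb big_seq1/= mul1r subrr normr0 ltW.
Qed.
Definition unit_vec k i : X := Predual (unit_vec_subproof k i).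

Definition entries f k i : R := f (unit_vec k i).

Lemma entriesD f f' : entries (f + f') = entries f + entries f'. Proof. by []. Qed.
Lemma entriesB f f' : entries (f - f') = entries f - entries f'. Proof. by []. Qed.
Lemma entriesZ (c : R) f : entries (c *: f) = c *: entries f. Proof. by []. Qed.

Lemma predualZE (c : R) (x : X) g : (c *: x) g = c * x g. Proof. by []. Qed.

Lemma predualDE (x y : X) g : (x + y) g = x g + y g. Proof. by []. Qed.

Lemma sum_predualE I (r : seq I) (P : pred I) (F : I -> X) g :
  (\sum_(i <- r | P i) F i : X) g = \sum_(i <- r | P i) F i g.
Proof.
by elim/big_rec2: _ => // i y x _ <-.
Qed.

(** The seminorm is the value of the functional at one vector of X of norm at most
    1: the combination of coordinates whose signs are those of the sums and of
    the entries.  Its norm is at most 1 because the same expression bounds it on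
    the unit ball of Y. *)
Lemma rho_entries_le f N q : rho N q (entries f) <= `|f|.
Proof.
pose A k : X := \sum_(i < q k) unit_vec k i.
pose B k : X := \sum_(i < q k) Num.sg (entries f k i) *: unit_vec k i.
pose u : X := \sum_(k < N) (Num.sg (f (A k)) *: A k + k.+1%:R^-1 *: B k).
have AE k : f (A k) = \sum_(i < q k) entries f k i by rewrite linear_sum.
have -> : rho N q (entries f) = f u.
  rewrite linear_sum; apply: eq_bigr => k _ /=.
  rewrite linearD !linearZ/= -normrEsg AE; congr (_ + _ * _).
  by rewrite linear_sum; apply: eq_bigr => i _; rewrite linearZ/= -normrEsg.
apply: le_trans (ler_norm _) _; apply: le_dual_norm.
apply: norm_predual_le => g.
apply: le_trans (ballP g N q).
rewrite sum_predualE (le_trans (ler_norm_sum _ _ _))// ler_sum// => k _.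
have sg1 (x : R) : `|Num.sg x| <= 1 by rewrite normr_sg lern1; case: eqP.
rewrite predualDE (le_trans (ler_normD _ _))// lerD//.
  by rewrite predualZE normrM sum_predualE ler_piMl.
rewrite predualZE normrM ger0_norm// ler_wpM2l ?invr_ge0// sum_predualE.
rewrite (le_trans (ler_norm_sum _ _ _))// ler_sum// => i _.
by rewrite predualZE normrM ler_piMl.
Qed.

Lemma pred_approx (x : X) e : 0 < e -> exists s : seq (R * (nat * nat)),
  `|x - \sum_(w <- s) w.1 *: unit_vec w.2.1 w.2.2| <= e.
Proof.
move=> e0; have /asboolP/(_ e e0)[s sx] := predual_funP x; exists s.
apply: norm_predual_le => g; rewrite (le_trans _ (sx g))//.
by rewrite [X in _ <= `|_ - X|]/comb -[X in `|X|]/(x g - (_ : X) g) sum_predualE.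
Qed.

Lemma entries_eq0 f : entries f = 0 -> f = 0.
Proof.
move=> f0; apply/val_inj/funext => x /=; apply/eqP.
rewrite -normr_le0; apply/ler_addgt0Pl => e e0; rewrite addr0.
have n0 : 0 < `|f| + 1 by rewrite ltr_wpDl.
have [s sx] := pred_approx x (divr_gt0 e0 n0).
have -> : f x = f (x - \sum_(w <- s) w.1 *: unit_vec w.2.1 w.2.2).
  rewrite linearB [X in _ - X](_ : _ = 0) ?subr0// linear_sum big1// => w _.
  rewrite linearZ /=.
  by rewrite [X in _ * X](congr1 (fun a => a w.2.1 w.2.2) f0) mulr0.
rewrite (le_trans (dual_norm_bound _ _))//.
apply: le_trans (_ : (`|f| + 1) * (e / (`|f| + 1)) <= _).
  by rewrite ler_pM// lerDl.
by rewrite mulrC divfK// gt_eqF.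
Qed.

Lemma entries_inj : injective entries.
Proof.
move=> f f' ff'; apply/eqP; rewrite -subr_eq0; apply/eqP/entries_eq0.
by rewrite entriesB ff' subrr.
Qed.

Fact eval_subproof (g : @array_ball R) : (fun x : X => x g) \in @dual_pred R X.
Proof.
apply: (@bounded_scalar_dual _ _ _ 1) => [c x y //|x].
by rewrite mul1r le_norm_predual.
Qed.
Definition eval (g : array_ball) : dual X := Dual (eval_subproof g).

(** A multiple of an array of the unit ball acts on X by evaluation. *)
Lemma entries_ex a (M : R) : 0 < M -> (forall N q, rho N q a <= M) ->
  exists2 f, entries f = a & `|f| <= M.
Proof.
move=> M0 aM; have gP N q : rho N q (M^-1 *: a) <= 1.
  by rewrite rhoZ gtr0_norm ?invr_gt0// ler_pdivrMl// mulr1.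
exists (M *: eval (ArrayBall gP)).
  by apply/funext => k; apply/funext => i; rewrite entriesZ; exact: (mulVKf (lt0r_neq0 M0)).
rewrite normrZ gtr0_norm// ler_piMr// ?(ltW M0)//.
by apply: (@dual_norm_le _ _ (eval _)) => x; exact/le_trans/le_norm_predual.
Qed.

(** By injectivity of [entries] the functional is a multiple of an evaluation, for
    which the bound is clear. *)
Lemma norm_dual_le f (M : R) : (forall N q, rho N q (entries f) <= M) -> `|f| <= M.
Proof.
move=> fM; apply/ler_addgt0Pl => e e0.
have M0 : 0 <= M by rewrite (le_trans _ (fM 0%N id))// rho_ge0.
have [||f' /entries_inj -> //] := @entries_ex (entries f) (e + M).
  by rewrite ltr_wpDr.
by move=> N q; rewrite (le_trans (fM N q))// lerDr ltW.
Qed.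

Lemma norm_dual_gt f (M : R) : M < `|f| -> exists N q, M < rho N q (entries f).
Proof.
move=> Mf; apply: contrapT => h; move: Mf; rewrite ltNge => /negP; apply.
apply: norm_dual_le => N q; rewrite leNgt; apply/negP => rM.
by apply: h; exists N, q.
Qed.

Lemma l1norm_entries_le f N n : l1norm N n (entries f) <= N%:R * `|f|.
Proof.
by rewrite (le_trans (l1norm_le_rho _ _ _))// ler_wpM2l// rho_entries_le.
Qed.

End duality.

(** * The weak* topology *)

Section weak_star_topology.
Context {R : realType} (X : normedModType R).
Implicit Types f : dual X.

Lemma weak_star_eval_continuous (x : X) :
  continuous (fun f : weak_star X => (f : dual X) x).
Proof.
move=> f; apply: (@continuous_comp (weak_star X) {ptws X -> R} R
  (fun f : dual X => dual_fun f) (fun h => h x)).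
  exact: initial_continuous.
exact: (@proj_continuous X (fun=> R) x).
Qed.

(** Pointwise convergence is all that a weak* neighbourhood can see. *)
Lemma weak_star_cvg (u : nat -> dual X) f :
  (forall x, u n x @[n --> \oo] --> f x) ->
  forall V : set (weak_star X), open V -> V f -> \forall n \near \oo, V (u n).
Proof.
move=> uf V [B Bo <-] Bf.
have : (fun n => dual_fun (u n)) @ \oo --> (dual_fun f : {ptws X -> R}).
  by apply/(@pointwise_cvgP X R _ (dual_fun f)).
apply; apply: open_nbhs_nbhs; split=> //.
Qed.
End weak_star_topology.

(** * Separability of the dual *)

Section dual_separable.
Context {R : realType}.
Notation X := (@predual R).

Definition rat_array (s : seq (seq rat)) (k i : nat) : R :=
  ratr (nth 0 (nth [::] s k) i).

Lemma rat_array_approx (a : nat -> nat -> R) N n (e : R) : 0 < e ->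
  exists s, [/\ forall k i, (N <= k)%N || (n <= i)%N -> rat_array s k i = 0 &
    l1norm N n (a - rat_array s) <= e].
Proof.
move=> e0; (* There are N * n entries in the box; the successor avoids dividing by 0. *)
pose d := e / (N * n).+1%:R.
have d0 : 0 < d by rewrite divr_gt0.
have near_rat (p : nat * nat) : exists r : rat, `|a p.1 p.2 - ratr r| <= d.
  have [|r] := @rat_in_itvoo R (a p.1 p.2 - d) (a p.1 p.2 + d).
    by lra.
  rewrite in_itv/= => /andP[? ?]; exists r.
  by rewrite ler_norml; apply/andP; split; lra.
have [r rP] := choice near_rat.
exists (mkseq (fun k => mkseq (fun i => r (k, i)) n) N); split.
  move=> k i; rewrite /rat_array; have [Nk _|kN /= ni] := leqP N k.
    by rewrite [nth [::] _ k]nth_default ?size_mkseq// nth_nil raddf0.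
  by rewrite nth_mkseq// nth_default ?size_mkseq// raddf0.
apply: (@le_trans _ _ (\sum_(k < N) \sum_(i < n) d)).
  apply: ler_sum => k _; apply: ler_sum => i _.
  rewrite -[X in `|X|]/(a k i - rat_array _ k i) /rat_array !nth_mkseq//.
  exact: (rP (k : nat, i : nat)).
rewrite !sumr_const !card_ord -mulrnA -mulr_natl mulrC /d mulrAC.
by rewrite ler_pdivrMr// ler_wpM2l ?(ltW e0)// ler_nat mulnC ltnW.
Qed.

(** Arrays with finitely many nonzero entries, all rational, approximate every
    array, by concentration on a box. *)
Lemma dual_predual_separable : separable (dual X).
Proof.
pose g s : dual X := xget 0 [set f | entries f = rat_array s].
exists (range g); first exact: card_le_trans (card_image_le _ _) (countableP _).
move=> O [f Of] Oo.
have /nbhs_ballP[e /= e0 eO] : nbhs f O by apply: open_nbhs_nbhs.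
(* [rho_boxB] turns errors of e / 10 on the box, off the box and in the tail
   into 5 * (e / 10). *)
have d0 : 0 < e / 10 by rewrite divr_gt0.
have [N [n [tf bf]]] := rho_concentrates d0 (rho_entries_le f).
have [s [s0 sf]] := rat_array_approx (entries f) N n d0.
have ts : tail_le N 0 (rat_array s).
  move=> N' q; rewrite big_nat big1// => k /andP[Nk _].
  have -> : rat_array s k = 0 *: 0 by apply/funext => i; rewrite s0 ?Nk// scale0r.
  by rewrite levnormZ normr0 mul0r.
have bs n' : l1norm N n' (rat_array s) <= l1norm N n (rat_array s) + 0.
  rewrite addr0 (le_trans (le_l1norm _ _ (leq_maxr n n')))//.
  apply: ler_sum => k _; rewrite -!(big_mkord xpredT (fun i => `|rat_array s k i|)).
  rewrite (big_cat_nat _ (leq_maxl n n'))//= -lerBrDl subrr big_nat big1//.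
  by move=> i /andP[ni _]; rewrite s0 ?ni ?orbT// normr0.
have fs := rho_boxB tf ts bf bs sf.
have [|h hE hle] := entries_ex _ fs; first by lra.
have gE : g s = f - h.
  apply: entries_inj; rewrite /g; case: xgetP => [_ -> -> //|].
    by rewrite entriesB hE opprB addrC subrK.
  by move=> /(_ (f - h)) []; rewrite /= entriesB hE opprB addrC subrK.
exists (g s); split; last by exists s.
apply: eO; rewrite -ball_normE /ball_/= gE opprB addrC subrK.
by rewrite (le_lt_trans hle)//; lra.
Qed.

End dual_separable.

(** * The derivations shrink the ball *)

Section szlenk_upper.
Context {R : realType}.
Notation X := (@predual R).

Lemma szlenk_small_diam (eps d : R) (K V : set (dual X)) (g : dual X) :
  szlenk_derivation eps K g -> open (V : set (weak_star X)) -> V g -> d < eps ->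
  ~ (forall h h', V h -> K h -> V h' -> K h' -> `|h - h'| <= d).
Proof.
move=> [_ +] Vo Vg de Vd; apply; exists V => //=; split=> //.
apply: le_lt_trans (_ : d%:E < eps%:E)%E; last by rewrite lte_fin.
apply: ge_ereal_sup => _ [h [Vh Kh] [h' [Vh' Kh'] <-]].
by rewrite lee_fin Vd.
Qed.

Lemma sum_weak_star_continuous n (F : nat -> weak_star X -> R) :
  (forall i, continuous (F i)) -> continuous (fun f => \sum_(i < n) F i f).
Proof.
move=> Fc; elim: n => [|n IH].
  by under eq_fun do rewrite big_ord0; exact: cst_continuous.
under eq_fun do rewrite big_ord_recr/=.
by move=> f; apply: (@continuousD R R^o); [exact: IH|exact: Fc].
Qed.

Lemma continuous_normr (T : topologicalType) (h : T -> R) :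
  continuous h -> continuous (fun x => `|h x|).
Proof.
move=> hc x; apply: (@continuous_comp _ _ _ h (fun y : R => `|y|)); first exact: hc.
exact: (@norm_continuous R R^o).
Qed.

Lemma l1norm_weak_star_continuous N n (a : nat -> nat -> R) :
  continuous (fun f : weak_star X => l1norm N n (entries f - a)).
Proof.
apply: (sum_weak_star_continuous (F := fun k f => \sum_(i < n) `|(entries f - a) k i|)).
move=> k; apply: (sum_weak_star_continuous (F := fun i f => `|(entries f - a) k i|)).
move=> i; apply: (continuous_normr (h := fun f : weak_star X => (entries f - a) k i)) => f.
have : {for f, continuous ((fun f : weak_star X => entries f k i : R^o) \- cst (a k i))}.
  apply: (@continuousB R R^o); last exact: cst_continuous.
  exact: weak_star_eval_continuous.
exact.
Qed.

Lemma rho_weak_star_continuous N q :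
  continuous (fun f : weak_star X => rho N q (entries f)).
Proof.
have entries_c k i : continuous (fun f : weak_star X => entries f k i).
  exact: weak_star_eval_continuous.
apply: (sum_weak_star_continuous (F := fun k f => levnorm k (q k) (entries f k))).
move=> k f; apply: (@continuousD R R^o _
    (fun f : weak_star X => `|\sum_(i < q k) entries f k i|)
    (fun f : weak_star X => k.+1%:R^-1 * \sum_(i < q k) `|entries f k i|)).
  move: f; apply: continuous_normr.
  exact: (sum_weak_star_continuous (F := fun i f => entries f k i)).
apply: (@continuousM R (weak_star X) (fun=> k.+1%:R^-1)); first exact: cst_continuous.
move: f; apply: (sum_weak_star_continuous (F := fun i f => `|entries f k i|)) => i.
exact: continuous_normr.
Qed.

(** Suppose f survives all the derivations and has norm above r - eps / 8.  A
    finite seminorm [rho N q] already exceeds this bound at f, and defines a weak*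
    open set V.  Elements of V of norm at most r have tails at most eps / 8
    beyond level N.  On the first N levels the l_1-norm, at most N * r, drops
    by eps / 48 at each derivation inside V: elements near the maximal value
    that agree approximately on a large box would otherwise form a weak* open
    slice of diameter below eps.  After finitely many steps nothing is left
    in V. *)
Lemma szlenk_omega_drop (eps r : R) (A : nat -> set (dual X)) f : 0 < eps ->
  (forall m, A m.+1 `<=` szlenk_derivation eps (A m)) ->
  (forall g, A 0%N g -> `|g| <= r) ->
  (forall m, A m f) -> `|f| <= r - eps / 8.
Proof.
move=> e0 AS A0r Af; rewrite leNgt; apply/negP => /norm_dual_gt[N [q fNq]].
have Am0 m : A m `<=` A 0%N.
  by elim: m => // m IH g /AS/szlenk_derivation_sub/IH.
have Ar m g : A m g -> `|g| <= r by move=> /Am0/A0r.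
pose V : set (weak_star X) := [set g | r - eps / 8 < rho N q (entries g)].
have Vo : open V.
  apply: (@open_comp _ _ (fun g : weak_star X => rho N q (entries g)) _ _ (@open_gt _ _)).
  by move=> g _; exact: rho_weak_star_continuous.
have drop m g n : A m g -> V g ->
    l1norm N n (entries g) <= N%:R * r - m%:R * (eps / 48).
  elim: m g n => [|m IH] g n Ag Vg.
    rewrite mul0r subr0 (le_trans (l1norm_entries_le _ _ _))// ler_wpM2l//.
    exact: A0r.
  rewrite leNgt; apply/negP => gn.
  pose W : set (weak_star X) :=
    [set h | l1norm N n (entries h - entries g) < eps / 48].
  have Wo : open W.
    apply: (@open_comp _ _ (fun h : weak_star X =>
      l1norm N n (entries h - entries g)) _ _ (@open_lt _ _)).
    by move=> h _; exact: l1norm_weak_star_continuous.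
  have Wg : W g by rewrite /W/= subrr -(subrr 0) (_ : l1norm _ _ _ = 0) ?divr_gt0//;
    rewrite subrr; do 2!(apply: big1 => ? _); rewrite normr0.
  (* The diameter is at most 2 * (3 * (eps / 24)) + 2 * (eps / 8) = eps / 2. *)
  have VWd : eps / 2 < eps by lra.
  apply: (szlenk_small_diam (AS _ _ Ag) (openI Vo Wo) (conj Vg Wg) VWd).
  have box h : V h -> W h -> A m h -> forall n',
      l1norm N n' (entries h) <= l1norm N n (entries h) + eps / 24.
    move=> Vh Wh Ah n'; have := IH h n' Ah Vh.
    have := l1normD N n (entries h) (entries g - entries h).
    rewrite subrKC -[entries g - _]opprB l1normN; move: Wh gn; rewrite /W/= -[m.+1%:R]natr1.
    by lra.
  move=> h h' [Vh Wh] Ah [Vh' Wh'] Ah'.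
  have tail k : V k -> A m k -> tail_le N (eps / 8) (entries k).
    move=> Vk Ak; apply: (@tail_of_rho _ r _ N q _ _ (ltW Vk)) => N' q'.
    by rewrite (le_trans (rho_entries_le _ _ _))// (Ar m).
  have hh' : l1norm N n (entries h - entries h') <= eps / 24.
    have -> : entries h - entries h' =
        entries h - entries g + - (entries h' - entries g).
      by rewrite opprB addrA subrK.
    rewrite (le_trans (l1normD _ _ _ _))// l1normN.
    by move: Wh Wh'; rewrite /W/=; lra.
  apply: norm_dual_le => N' q'; rewrite entriesB.
  apply: le_trans (rho_boxB (tail _ Vh Ah) (tail _ Vh' Ah') (box _ Vh Wh Ah)
    (box _ Vh' Wh' Ah') hh' _ _) _.
  by lra.
have e48 : 0 < eps / 48 by rewrite divr_gt0.
have [m mP] : exists m, N%:R * r < m%:R * (eps / 48).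
  exists (Num.bound `|N%:R * r / (eps / 48)|).
  rewrite -ltr_pdivrMr// (le_lt_trans (ler_norm _))//.
  exact: archi_boundP.
by have := drop m f 0%N (Af m) fNq; have := l1norm_ge0 N 0 (entries f); lra.
Qed.

End szlenk_upper.

(** * The derivations preserve a smaller ball *)

Section szlenk_lower.
Context {R : realType}.
Notation X := (@predual R).
Implicit Types (b : nat -> R).

Definition at_level k b (l : nat) : nat -> R := if l == k then b else 0.

Definition dipole (i j : nat) : R := (j == i)%:R - (j == i.+1)%:R.

(** The properties of a sum of J disjoint pulses that are kept when a further one
    is added.  The prefix sums stay in [0, 1], so that only the l_1 part of the
    norm grows with J, and vanish from n on, so that the next pulse can start at
    any position after n. *)
Definition pulses J n b : Prop :=
  [/\ forall q, 0 <= \sum_(i < q) b i <= 1,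
      forall q, (n <= q)%N -> \sum_(i < q) b i = 0 &
      forall q, \sum_(i < q) `|b i| <= J%:R * 2].

Lemma sum_delta (i q : nat) : \sum_(j < q) ((j : nat) == i)%:R = (i < q)%:R :> R.
Proof.
have [iq|qi] := ltnP i q.
  rewrite (bigD1 (Ordinal iq))//= eqxx big1 ?addr0// => j.
  by rewrite -val_eqE/= => /negPf ->.
rewrite big1// => j _; case: eqP => // ji.
by have := leq_trans (ltn_ord j) qi; rewrite ji ltnn.
Qed.

Lemma sum_dipole i q : \sum_(j < q) dipole i j = (q == i.+1)%:R.
Proof.
rewrite big_split sumrN /= !sum_delta.
by case: (ltngtP q i.+1) => h; do ?case: ltnP => ?; rewrite ?subrr ?subr0//; lia.
Qed.

Lemma pulses0 : pulses 0 0 0.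
Proof.
by split=> [q|q _|q]; rewrite big1 ?lexx ?ler01 ?mul0r// => i _; rewrite normr0.
Qed.

Lemma pulsesS J n i b : pulses J n b -> (n <= i)%N ->
  pulses J.+1 i.+2 (b + dipole i).
Proof.
move=> [b01 b0 bJ] ni.
have sE q : \sum_(j < q) (b + dipole i) j = \sum_(j < q) b j + (q == i.+1)%:R.
  by rewrite -sum_dipole -big_split.
split=> q.
- rewrite sE; case: eqP => [->|_]; last by rewrite addr0.
  by rewrite b0 ?add0r ?ler01 ?lexx// ltnW.
- by move=> iq; rewrite sE b0 ?gtn_eqF ?addr0//; lia.
- apply: (@le_trans _ _ (\sum_(j < q) `|b j| + \sum_(j < q) `|dipole i j|)).
    by rewrite -big_split ler_sum// => j _; exact: ler_normD.
  rewrite -natr1 mulrDl mul1r lerD//.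
  apply: (@le_trans _ _ (\sum_(j < q) ((j : nat) == i)%:R +
                         \sum_(j < q) ((j : nat) == i.+1)%:R)).
    rewrite -big_split ler_sum// => j _.
    by rewrite (le_trans (ler_normB _ _))// !normr_nat.
  by rewrite !sum_delta -natrD (@ler_nat _ _ 2); do 2!case: (_ < _)%N.
Qed.

(** On level k the l_1-norm, at most 2 J, is divided by k + 1. *)
Lemma pulses_dual J n b k : pulses J n b -> (J <= k.+1)%N ->
  exists2 g : dual X, entries g = at_level k b & `|g| <= 3.
Proof.
move=> [b01 _ bJ] Jk; apply: entries_ex => // N q.
apply: (@le_trans _ _ (levnorm k (q k) b)).
  rewrite /rho; have [kN|Nk] := ltnP k N; last first.
    rewrite big1 ?levnorm_ge0// => l _.
    rewrite /at_level ltn_eqF ?(leq_trans (ltn_ord l))//.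
    by rewrite -(scale0r 0) levnormZ normr0 mul0r.
  rewrite (bigD1 (Ordinal kN))//= big1 ?addr0 /at_level ?eqxx// => l.
  rewrite -val_eqE/= => /negPf ->.
  by rewrite -(scale0r 0) levnormZ normr0 mul0r.
have /andP[b0 b1] := b01 (q k); rewrite /levnorm ger0_norm//.
have -> : 3 = 1 + 2 :> R by ring.
by rewrite lerD// ler_pdivrMl// (le_trans (bJ _))// ler_wpM2r// ler_nat.
Qed.

(** A coordinate vanishes on all the pulses far enough, and coordinates span a
    dense subspace on which bounded functionals are controlled. *)
Lemma dipole_dual_null (D : nat -> dual X) k :
  (forall i, entries (D i) = at_level k (dipole i)) -> (forall i, `|D i| <= 3) ->
  forall x, D i x @[i --> \oo] --> (0 : R).
Proof.
move=> DE D3 x; apply/cvgrPdist_le => e e0.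
have [s xs] := @pred_approx R x (e / 3) ltac:(by rewrite divr_gt0).
near=> i; rewrite sub0r normrN.
have -> : D i x = D i (x - \sum_(w <- s) w.1 *: unit_vec w.2.1 w.2.2).
  rewrite linearB [X in _ - X](_ : _ = 0) ?subr0// linear_sum big_seq big1// => w ws.
  rewrite linearZ/= [X in _ * X](congr1 (fun a => a w.2.1 w.2.2) (DE i)).
  have wi : (w.2.2 < i)%N.
    have si : (\max_(w <- s) w.2.2 < i)%N by near: i; exact: nbhs_infty_gt.
    by apply: leq_ltn_trans si; exact: leq_bigmax_seq.
  rewrite /at_level; case: eqP => _; last by rewrite mulr0.
  by rewrite /dipole !ltn_eqF ?subrr ?mulr0// ltnW.
rewrite (le_trans (dual_norm_bound _ _))//.
by rewrite (le_trans (ler_pM _ _ (D3 i) xs))//; lra.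
Unshelve. all: by end_near. Qed.

Lemma szlenk_intro (eps : R) (K : set (dual X)) f : K f ->
  (forall V : set (weak_star X), open V -> V f ->
    exists g, [/\ V g, K g & eps <= `|g - f|]) ->
  szlenk_derivation eps K f.
Proof.
move=> Kf fV; split=> // -[V [Vo dV] Vf].
have [g [Vg Kg eg]] := fV V Vo Vf.
move: dV; rewrite ltNge => /negP; apply.
apply: le_trans (_ : (`|g - f|%:E <= _)%E); first by rewrite lee_fin.
by apply: ereal_sup_ubound; exists g => //; exists f.
Qed.

(** To survive m derivations, work on level m and keep a stock of pulses: an
    element with J pulses is the weak* limit of elements with J + 1 pulses at
    distance at least d / 3, hence survives one derivation more than they do.
    The pulses, scaled by d / 3, cost at most d in norm. *)
Lemma szlenk_omega_stay (eps d r : R) (A : nat -> set (dual X)) f :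
  0 < d -> eps <= d / 3 ->
  (forall m, szlenk_derivation eps (A m) `<=` A m.+1) ->
  (forall g, `|g| <= r -> A 0%N g) ->
  `|f| <= r - d -> forall m, A m f.
Proof.
move=> d0 ed AS A0 fr m.
have dip i : pulses 1 i.+2 (dipole i).
  by rewrite -[dipole i]add0r; exact: pulsesS pulses0 _.
have Dex i := @pulses_dual 1 _ _ m (dip i) isT.
pose D i := projT1 (cid2 (Dex i)).
have DE i : entries (D i) = at_level m (dipole i) by rewrite /D; case: cid2.
have D3 i : `|D i| <= 3 by rewrite /D; case: cid2.
have D1 i : 1 <= `|D i|.
  apply: le_trans (rho_entries_le _ m.+1 (fun=> i.+1)).
  rewrite DE /rho big_ord_recr/= ler_wpDl ?rho_ge0//.
    by apply: sumr_ge0 => k _; exact: levnorm_ge0.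
  rewrite /levnorm /at_level eqxx sum_dipole eqxx normr1 lerDl.
  by rewrite mulr_ge0// sumr_ge0.
suff key j J n b g : (j + J <= m)%N -> pulses J n b ->
    entries g = at_level m b -> A j (f + (d / 3) *: g).
  have := key m 0%N 0%N 0 0; rewrite addn0 scaler0 addr0; apply=> //.
    exact: pulses0.
  by apply/funext => l; rewrite /at_level; case: eqP.
elim: j J n b g => [|j IH] J n b g jm bP gE.
  have [|g' /esym g'E g'3] := @pulses_dual J n b m bP; first exact: ltnW.
  have -> : g = g' by apply: entries_inj; rewrite gE g'E.
  apply: A0; rewrite (le_trans (ler_normD _ _))// normrZ gtr0_norm ?divr_gt0//.
  have := ler_pM (ltW (divr_gt0 d0 (ltr0Sn R 2))) (normr_ge0 _) (lexx _) g'3.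
  by move: fr; lra.
apply/AS/szlenk_intro; first by apply: IH bP gE; lia.
move=> V Vo Vf.
pose u i := f + (d / 3) *: (g + D i).
have : \forall i \near \oo, V (u i).
  apply: weak_star_cvg Vo Vf => x.
  rewrite -[X in _ --> X]addr0; under eq_fun do rewrite /u scalerDr addrA dualDE.
  apply: (@cvgD R R^o); first exact: cvg_cst.
  rewrite -(mulr0 (d / 3)); apply: (@cvgM R); first exact: cvg_cst.
  exact: dipole_dual_null DE D3 x.
move=> Vu; near \oo => i; exists (u i); split.
- by near: i.
- have ni : (n <= i)%N by near: i; exact: nbhs_infty_ge.
  apply: (IH J.+1 i.+2 (b + dipole i)); first by lia.
    exact: pulsesS bP ni.
  rewrite entriesD gE DE; apply/funext => l; rewrite /at_level.
  rewrite -[LHS]/((if l == m then b else 0) + (if l == m then dipole i else 0)).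
  by case: eqP; rewrite ?addr0.
- rewrite /u scalerDr addrA [X in `|X|]addrC addKr normrZ gtr0_norm ?divr_gt0//.
  by rewrite (le_trans ed)// ler_peMr ?D1// ltW// divr_gt0.
Unshelve. all: by end_near. Qed.

End szlenk_lower.

(** * The Szlenk index *)

Section szlenk_index.
Context {R : realType}.
Notation X := (@predual R).

(** The stages alpha + m are cofinal in alpha + omega, which has no greatest
    child. *)
Lemma derived_oplus_omega T (s : set T -> set T) (K : set T) a :
  (forall A, s A `<=` A) ->
  derived s K (oplus_omega a) = \bigcap_m derived s K (iter m osucc a).
Proof.
move=> s_sub; apply/seteqP; split=> x.
  by move=> ax m _; apply: derived_anti ax => //; exact/oltW/olt_child.
move=> ax; split=> [/(_ 0%N)//|m _|_ m]; last exact: ax.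
by rewrite -derivedS; exact: (ax m.+1).
Qed.

Lemma szlenk_derived_le (eps : R) n f : 0 < eps ->
  szlenk_derived eps (iter n oplus_omega ozero) f ->
  `|f : dual X| <= 1 - n%:R * (eps / 8).
Proof.
move=> e0; elim: n f => [|n IH] f.
  by rewrite mul0r subr0 /szlenk_derived derived0 => -[].
rewrite /szlenk_derived iterS derived_oplus_omega; last exact: szlenk_derivation_sub.
move=> fm; rewrite -[n.+1%:R]natr1 mulrDl mul1r opprD addrA.
apply: (szlenk_omega_drop (A := fun m => szlenk_derived eps (iter m osucc _)) e0
  _ IH) => [m|m]; last exact: fm.
by rewrite /szlenk_derived iterS derivedS.
Qed.

Lemma szlenk_derived_ge (d : R) n f : 0 < d -> `|f : dual X| <= 1 - n.+1%:R * d ->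
  szlenk_derived (d / 3) (iter n oplus_omega ozero) f.
Proof.
move=> d0; elim: n f => [|n IH] f.
  rewrite mul1r /szlenk_derived derived0.
  move=> fd.
  exact: (@szlenk_omega_stay _ (d / 3) d 1
    (fun m => iter m (szlenk_derivation (d / 3)) (@dual_ball R X)) f d0 (lexx _)
    (fun m => @subset_refl _ _) (fun g gr => gr) fd 1%N).
rewrite /szlenk_derived iterS derived_oplus_omega; last exact: szlenk_derivation_sub.
rewrite -[n.+2%:R]natr1 mulrDl mul1r opprD addrA => fd m _.
set a := iter n _ _ in IH *.
pose A k : set (dual X) := szlenk_derived (d / 3) (iter k osucc a).
suff AS k : szlenk_derivation (d / 3) (A k) `<=` A k.+1.
  exact: (szlenk_omega_stay d0 (lexx _) AS IH fd).
by rewrite /A /szlenk_derived iterS derivedS.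
Qed.

Lemma ord_least (P : Ord -> Prop) a : P a -> exists2 b, P b & forall c, P c -> ole b c.
Proof.
elim/olt_ind: a => a IH Pa.
have [|/existsNP[b /not_implyP[Pb ab]]] := pselect (forall b, P b -> ole a b).
  by exists a.
by apply: (IH b) => //; exact/oltNge.
Qed.

Lemma is_Sz_eps_ex (eps : R) : 0 < eps -> exists2 b, is_Sz_eps X eps b & ole b omega2.
Proof.
move=> e0; set P := fun b => @szlenk_derived R X eps b = set0.
pose n := Num.bound (8 / eps).
have nP : P (iter n oplus_omega ozero).
  apply/seteqP; split=> // f /(szlenk_derived_le e0) fn.
  have := le_trans (normr_ge0 _) fn; apply/negP; rewrite -ltNge subr_lt0.
  rewrite -ltr_pdivrMr ?divr_gt0// div1r invf_div.
  by apply: archi_boundP; rewrite divr_ge0// ltW.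
have [b Pb bmin] := ord_least nP; exists b; first by split.
by apply: ole_trans (bmin _ nP) _; exact/oltW/(@olt_child _ (fun n => iter n oplus_omega ozero)).
Qed.

(** Upper bounds come from [is_Sz_eps_ex].  For the supremum, the parameter
    1 / (3 (n + 1)) leaves 0 in the stage omega * n. *)
Lemma is_Sz_predual : is_Sz X omega2.
Proof.
split=> [eps /is_Sz_eps_ex//|c cub].
have : forall n, olt (iter n oplus_omega ozero) c.
  move=> n; pose d : R := n.+1%:R^-1.
  have d0 : 0 < d by rewrite invr_gt0.
  have [b bS _] := is_Sz_eps_ex (divr_gt0 d0 (ltr0Sn R 2)).
  apply: olt_le_trans (cub _ _ (divr_gt0 d0 (ltr0Sn R 2)) bS).
  apply/oltNge => bn.
  have : szlenk_derived (d / 3) (iter n oplus_omega ozero) (0 : dual X).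
    by apply: szlenk_derived_ge => //; rewrite normr0 mulfV// subrr.
  by move/(derived_anti (@szlenk_derivation_sub R X _) bn); rewrite [derived _ _ _]bS.1.
by case: c {cub} => J g h n; apply/olt_osup; exact: h.
Qed.

End szlenk_index.

(** * The embedding of the Kalton graph *)

Section kalton_embedding.
Context {R : realType}.
Notation X := (@predual R).
Implicit Types (n m : kalton).

Definition ind n (i : nat) : R := (i \in val n)%:R.
Definition prefix n q : R := \sum_(i < q) ind n i.

Lemma sum_lt (N q : nat) : \sum_(k < N) (k < q)%:R = (minn N q)%:R :> R.
Proof.
elim: N => [|N IH]; first by rewrite big_ord0 min0n.
by rewrite big_ord_recr/= IH -natrD; congr _%:R; case: ltnP; lia.
Qed.

Lemma sum_itv (N p q : nat) : (p <= q)%N ->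
  \sum_(k < N) (p <= k < q)%:R = (minn N q)%:R - (minn N p)%:R :> R.
Proof.
move=> pq; rewrite -!sum_lt -sumrB; apply: eq_bigr => k _.
case: (ltnP k p) => kp /=; last by rewrite subr0.
by rewrite (leq_trans kp pq) subrr.
Qed.

Lemma sum_itv_le (N p q : nat) : (p <= q)%N ->
  \sum_(k < N) (p <= k < q)%:R <= q%:R - p%:R :> R.
Proof. by move=> pq; rewrite sum_itv// -(natrB _ pq) -natrB ?ler_nat; lia. Qed.

Lemma kalton_bound n m : exists b, forall i, (b <= i)%N -> ind n i = 0 /\ ind m i = 0.
Proof.
exists (\max_(i <- val n) i + \max_(i <- val m) i).+1 => i bi; rewrite /ind.
have notin (A : kalton) : (\max_(j <- val A) j < i)%N -> (i \in val A) = false.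
  move=> Ai; apply/negP => iA.
  have := @leq_bigmax_seq _ _ xpredT id i iA isT.
  by move=> /leq_ltn_trans/(_ Ai); rewrite ltnn.
by rewrite !notin//; apply: leq_trans bi; rewrite ltnS ?leq_addr ?leq_addl.
Qed.

Lemma card_in_sum n (S : set nat) b : (forall i, (b <= i)%N -> ind n i = 0) ->
  (card_in n S)%:R = \sum_(i < b) ind n i * ((i : nat) \in S)%:R :> R.
Proof.
move=> nb.
have nin i : (b <= i)%N -> (i \in val n) = false.
  by move=> /nb/eqP; rewrite /ind; case: (i \in val n) => //; rewrite oner_eq0.
rewrite /card_in; set A := [fset i in val n | i \in S]%fset.
have -> : #|` A| = size [seq i <- index_iota 0 b | i \in A].
  apply: perm_size; apply: uniq_perm; rewrite ?fset_uniq ?filter_uniq ?iota_uniq//.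
  move=> i; rewrite mem_filter mem_index_iota /=.
  case: ltnP => [_|bi]; rewrite ?andbT ?andbF// /A !inE/= nin//.
rewrite size_filter -sum1_count big_mkcond natr_sum big_mkord.
apply: eq_bigr => i _; rewrite /A !inE /ind -natrM mulnb.
by case: (_ && _).
Qed.

Lemma card_in_prefix n q : (card_in n [set i | (0 < i < q)%N])%:R = prefix n q.
Proof.
have [b nb] := kalton_bound n n.
rewrite (@card_in_sum n _ (maxn b q)); last first.
  by move=> i bi; have [] := nb i (leq_trans (leq_maxl _ _) bi).
rewrite /prefix (big_ord_widen _ (ind n) (leq_maxr b q)) [RHS]big_mkcond.
apply: eq_bigr => i _; have [->|i0] := posnP i.
  by rewrite /ind (negPf (valP n)) mul0r if_same.
have -> : ((i : nat) \in [set i | (0 < i < q)%N]) = (i < q)%N.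
  by apply/idP/idP => [/set_mem/andP[]//|iq]; apply/mem_set/andP.
by case: ltnP; rewrite ?mulr1 ?mulr0.
Qed.

(** On a bounded range a segment is an interval of integers, so its counts are
    differences of prefix counts: up to a factor 2, the distance dK only sees
    prefixes. *)
Lemma segment_prefix n m (S : set nat) : segment S -> exists p q : nat,
  (card_in n S)%:R = prefix n q - prefix n p /\
  (card_in m S)%:R = prefix m q - prefix m p.
Proof.
move=> [_ Sconv]; have [b nmb] := kalton_bound n m.
have [p [q [pq [qb Spq]]]] : exists p q : nat, (p <= q)%N /\ (q <= b)%N /\
    forall i, (i < b)%N -> (i \in S) = (p <= i < q)%N.
  have [[i0 /andP[i0b i0S]]|noS] := pselect (exists i, (i < b)%N && (i \in S)); last first.
    exists 0%N, 0%N; split=> //; split=> // i ib; rewrite ltn0 andbF.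
    by apply/negP => iS; apply: noS; exists i; rewrite ib.
  pose P i := (i < b)%N && (i \in S).
  have exP : exists i, P i by exists i0; apply/andP.
  have Pb i : P i -> (i <= b)%N by case/andP => /ltnW.
  case: (ex_minnP exP) => p /andP[pb pS] pmin.
  case: (ex_maxnP exP Pb) => q /andP[qb qS] qmax.
  exists p, q.+1; split; first by rewrite ltnW// ltnS pmin// /P qb.
  split=> // i ib; apply/idP/andP => [iS|[pi iq]].
    by rewrite ltnS pmin ?qmax// /P ib.
  by apply/mem_set; apply: (Sconv p i q); [exact/set_mem|exact/set_mem|rewrite pi].
have prefixE (A : kalton) : (forall i, (b <= i)%N -> ind A i = 0) ->
    (card_in A S)%:R = prefix A q - prefix A p.
  move=> Ab; rewrite (card_in_sum S Ab) /prefix.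
  rewrite (big_ord_widen _ (ind A) qb) (big_ord_widen _ (ind A) (leq_trans pq qb)).
  rewrite !(big_mkcond (fun i : 'I_b => (i < _)%N)) -sumrB; apply: eq_bigr => i _.
  rewrite Spq//; case: (ltnP i p) => ip /=.
    by rewrite (leq_trans ip pq) subrr mulr0.
  by case: ltnP; rewrite ?mulr1 ?mulr0 subr0.
exists p, q; split; apply: prefixE => i /nmb[]//.
Qed.

Lemma prefix_le_dK n m q : `|prefix n q - prefix m q| <= dK R n m.
Proof.
rewrite -!card_in_prefix; apply: (ub_le_sup (has_sup_dK R n m).2).
exists [set i | (0 < i < q)%N] => //; split=> [i /andP[]//|i j k /=].
by move=> /andP[? ?] /andP[? ?] /andP[? ?]; apply/andP; split; lia.
Qed.

Lemma prefix_le_card n q : prefix n q <= #|` val n|%:R.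
Proof.
rewrite -card_in_prefix ler_nat; apply: fsubset_leq_card; exact: fset_sub.
Qed.

Lemma prefix_card n b : (forall i, (b <= i)%N -> ind n i = 0) ->
  prefix n b = #|` val n|%:R.
Proof.
move=> nb; rewrite (_ : #|` val n| = card_in n setT); last first.
  rewrite /card_in; congr #|` _|; apply/fsetP => i; rewrite !inE/=.
  by rewrite mem_setT andbT.
rewrite (card_in_sum setT nb).
by apply: eq_bigr => i _; rewrite mem_setT mulr1.
Qed.

Lemma card_le_dK n m : `|#|` val n|%:R - #|` val m|%:R| <= dK R n m.
Proof.
have [b nmb] := kalton_bound n m.
by rewrite -!(@prefix_card _ b) ?prefix_le_dK// => i /nmb[].
Qed.

(** Distinct sets differ at some i, so their prefix counts cannot agree at both i
    and i + 1.  The value 1 / 2, instead of 1, is what prefixes alone give. *)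
Lemma dK_ge_half n m : n <> m -> 1 / 2 <= dK R n m.
Proof.
move=> nm; have [i ni] : exists i, (i \in val n) != (i \in val m).
  apply: contrapT => h; apply/nm/val_inj/fsetP => i; apply/eqP; apply: contrapT.
  by move=> /negP hi; apply: h; exists i.
have := prefix_le_dK n m i.+1; have := prefix_le_dK n m i.
rewrite /prefix !big_ord_recr/= -/(prefix n i) -/(prefix m i) /ind !ler_norml.
move: ni; case: (i \in _); case: (i \in _) => //= _ /andP[? ?] /andP[? ?]; lra.
Qed.

Lemma dK_le n m (M : R) : (forall q, `|prefix n q - prefix m q| <= M) ->
  dK R n m <= 2 * M.
Proof.
move=> hM; apply: ge_sup (has_sup_dK R n m).1 _ => _ [S Ss <-].
have [p [q [-> ->]]] := segment_prefix n m Ss; rewrite mulr_natl mulr2n.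
have -> : prefix n q - prefix n p - (prefix m q - prefix m p) =
  (prefix n q - prefix m q) - (prefix n p - prefix m p) by ring.
by rewrite (le_trans (ler_normB _ _))// lerD.
Qed.

(** A probability vector on the levels t <= k < 2 t.  The value for t = 0 is 0. *)
Definition weight (t k : nat) : R := (t <= k < t.*2)%:R / t%:R.

Definition spread n (k : nat) : nat -> R := weight #|` val n| k *: ind n.

Lemma weight_ge0 t k : 0 <= weight t k.
Proof. by rewrite /weight divr_ge0. Qed.

Lemma sum_weight_le t N : \sum_(k < N) weight t k <= 1.
Proof.
rewrite -mulr_suml; case: t => [|t]; first by rewrite invr0 mulr0.
rewrite ler_pdivrMr// mul1r (le_trans (sum_itv_le _ _))//; first by lia.
by rewrite -addnn natrD addrK.
Qed.

Lemma sum_weight t N : (0 < t)%N -> (t.*2 <= N)%N -> \sum_(k < N) weight t k = 1.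
Proof.
move=> t0 tN; rewrite -mulr_suml sum_itv; last by lia.
by rewrite !(minn_idPr _) ?(leq_trans _ tN)//; [rewrite -addnn natrD addrK mulfV// pnatr_eq0|]; lia.
Qed.

(** The two probability vectors differ by their ends [s, t) and [2 s, 2 t), where
    the weights are at most 1 / s and 1 / t, and by the change of height on the
    overlap. *)
Lemma sum_weight_dist s t N : (s <= t)%N ->
  s%:R * (\sum_(k < N) `|weight s k - weight t k|) <= 4 * (t%:R - s%:R).
Proof.
move=> st; have st0 : 0 <= t%:R - s%:R :> R by rewrite subr_ge0 ler_nat.
have [->|s0] := posnP s; first by rewrite mul0r subr0 mulr_ge0.
have sR : 0 < s%:R :> R by rewrite ltr0n.
have tR : 0 < t%:R :> R by rewrite ltr0n (leq_trans s0).
have pt k : s%:R * `|weight s k - weight t k| <= (s <= k < t)%:R +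
    (s.*2 <= k < t.*2)%:R + (t%:R - s%:R) / s%:R * (s <= k < s.*2)%:R.
  have ts0 : 0 <= (t%:R - s%:R) / s%:R :> R by rewrite divr_ge0.
  rewrite /weight -[X in X * _]gtr0_norm// -normrM mulrBr.
  case: (boolP (s <= k < s.*2)%N) => [/andP[sk ks]|ks];
  case: (boolP (t <= k < t.*2)%N) => [/andP[tk kt]|kt].
  - rewrite !mul1r mulfV ?gt_eqF// mulr1.
    have -> : 1 - s%:R / t%:R = (t%:R - s%:R) / t%:R :> R.
      by rewrite mulrBl mulfV// gt_eqF.
    rewrite ger0_norm ?divr_ge0// ler_wpDl//.
    by rewrite ler_wpM2l// lef_pV2// ler_nat.
  - rewrite mul1r mulfV ?gt_eqF// mul0r mulr0 subr0 normr1.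
    have -> : (s <= k < t)%N by lia.
    by rewrite -addrA lerDl addr_ge0// mulr_ge0.
  - rewrite mul1r mul0r mulr0 sub0r normrN ger0_norm ?divr_ge0//.
    have -> : (s.*2 <= k < t.*2)%N by lia.
    rewrite mulr0 addr0 (@le_trans _ _ 1) ?lerDr//.
    by rewrite ler_pdivrMr// mul1r ler_nat.
  - by rewrite !mul0r mulr0 subr0 normr0 !addr_ge0// mulr_ge0.
rewrite mulr_sumr (le_trans (ler_sum _ (fun (k : 'I_N) _ => pt k)))//.
rewrite !big_split/= -mulr_sumr.
have h1 := sum_itv_le N st.
have h2 : \sum_(k < N) (s.*2 <= k < t.*2)%:R <= 2 * (t%:R - s%:R) :> R.
  rewrite (le_trans (sum_itv_le _ _)) ?leq_double// -!muln2 !natrM.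
  by rewrite mulrC mulrBr ![2 * _]mulrC.
have h3 : (t%:R - s%:R) / s%:R * \sum_(k < N) (s <= k < s.*2)%:R <= t%:R - s%:R :> R.
  apply: (@le_trans _ _ ((t%:R - s%:R) / s%:R * s%:R)).
    rewrite ler_wpM2l ?divr_ge0// (le_trans (sum_itv_le _ _)) -?addnn ?leq_addr//.
    by rewrite natrD addrK.
  by rewrite divfK// gt_eqF.
lra.
Qed.

Lemma prefix_abs n q : \sum_(i < q) `|ind n i| = prefix n q.
Proof. by apply: eq_bigr => i _; rewrite normr_nat. Qed.

Lemma prefix_ge0 n q : 0 <= prefix n q.
Proof. exact: sumr_ge0. Qed.

Lemma levnorm_ind_le n k q : levnorm k q (ind n) <= 2 * #|` val n|%:R.
Proof.
by rewrite (le_trans (levnorm_le_l1 _ _ _))// prefix_abs ler_wpM2l ?prefix_le_card.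
Qed.

(** On the levels of positive weight k is at least the two cardinalities, so
    the l_1 part contributes at most 2, which is absorbed by 4 * dK. *)
Lemma weight_levnorm_le n m k q : n <> m -> (#|` val n| <= #|` val m|)%N ->
  weight #|` val m| k * levnorm k q (ind n - ind m) <=
  weight #|` val m| k * (5 * dK R n m).
Proof.
move=> nm; set s := #|` val n|; set t := #|` val m| => st.
have D := dK_ge_half nm.
rewrite /weight; case: (boolP (t <= k < t.*2)%N) => [/andP[tk _]|_]; last by rewrite !mul0r.
rewrite ler_wpM2l ?divr_ge0// /levnorm.
have l1 : \sum_(i < q) `|(ind n - ind m) i| <= 2 * k.+1%:R.
  apply: (@le_trans _ _ (prefix n q + prefix m q)).
    rewrite -!prefix_abs -big_split ler_sum// => i _; exact: ler_normB.
  rewrite mulr_natl mulr2n lerD// (le_trans (prefix_le_card _ _))// ler_nat.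
    by rewrite ltnW// ltnS (leq_trans st tk).
  by rewrite ltnW// ltnS.
have -> : \sum_(i < q) (ind n - ind m) i = prefix n q - prefix m q.
  by rewrite -sumrB.
have h : k.+1%:R^-1 * (\sum_(i < q) `|(ind n - ind m) i|) <= 2.
  by rewrite ler_pdivrMl// mulrC.
by rewrite (le_trans (lerD (prefix_le_dK n m q) h))//; lra.
Qed.

(** With s = |n| and t = |m|, the difference is that of the indicators, with the
    weights of t, plus the indicator of n times the difference of the weights.  The latter
    costs s * O((t - s) / s), and t - s is at most dK. *)
Lemma rho_spread_le n m N q : (#|` val n| <= #|` val m|)%N ->
  rho N q (spread n - spread m) <= 13 * dK R n m.
Proof.
move=> st; have [->|nm] := pselect (n = m).
  rewrite subrr rho0 mulr_ge0//.
  by rewrite (le_trans _ (prefix_le_dK m m 0))// normr_ge0.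
set s := #|` val n|; set t := #|` val m|.
have E k : (spread n - spread m) k =
    weight t k *: (ind n - ind m) + (weight s k - weight t k) *: ind n.
  by apply/funext => i; rewrite /spread !fctE -/s -/t /GRing.scale/=; ring.
apply: (@le_trans _ _ (\sum_(k < N) (weight t k * (5 * dK R n m) +
    `|weight s k - weight t k| * (2 * s%:R)))).
  apply: ler_sum => k _; rewrite E (le_trans (levnormD _ _ _ _))// !levnormZ.
  rewrite lerD ?ler_wpM2l ?levnorm_ind_le//.
  by rewrite ger0_norm ?weight_ge0// weight_levnorm_le.
rewrite big_split/= -[X in X + _]mulr_suml -[X in _ + X]mulr_suml.
have h1 : (\sum_(k < N) weight t k) * (5 * dK R n m) <= 5 * dK R n m.
  rewrite ler_piMl ?sum_weight_le// mulr_ge0//.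
  by rewrite (le_trans _ (dK_ge_half nm)).
have h2 := sum_weight_dist N st.
have h3 : t%:R - s%:R <= dK R n m.
  by rewrite (le_trans _ (card_le_dK n m))// distrC ler_norm.
by move: h1 h2 h3; rewrite -/s -/t; lra.
Qed.

Lemma rho_spread n m N q : rho N q (spread n - spread m) <= 13 * dK R n m.
Proof.
have [|/ltnW] := leqP #|` val n| #|` val m|; first exact: rho_spread_le.
move=> /(@rho_spread_le _ _ N q); rewrite -opprB rhoN => /le_trans; apply.
rewrite ler_pM2l// /dK le_eqVlt; apply/orP; left; apply/eqP; congr sup.
by apply/seteqP; split=> _ [S Ss <-]; exists S => //; rewrite distrC.
Qed.

(** Summing the prefixes over all the levels recovers the prefix counts, since the
    weights add up to 1. *)
Lemma prefix_spread_le n m q : exists N,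
  `|prefix n q - prefix m q| <= rho N (fun=> q) (spread n - spread m).
Proof.
exists (#|` val n|.*2 + #|` val m|.*2)%N; set N := (_ + _)%N.
have E (A : kalton) : (#|` val A|.*2 <= N)%N ->
    prefix A q = \sum_(k < N) \sum_(i < q) spread A k i.
  move=> AN; have -> : \sum_(k < N) \sum_(i < q) spread A k i =
      (\sum_(k < N) weight #|` val A| k) * prefix A q.
    by rewrite mulr_suml; apply: eq_bigr => k _; rewrite mulr_sumr.
  have [A0|A0] := posnP #|` val A|; last by rewrite sum_weight// mul1r.
  suff -> : prefix A q = 0 by rewrite mulr0.
  by apply/eqP; rewrite eq_le prefix_ge0 andbT (le_trans (prefix_le_card A q))// A0.
rewrite (E n) ?leq_addr// (E m) ?leq_addl// -sumrB (le_trans (ler_norm_sum _ _ _))//.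
apply: ler_sum => k _; rewrite -sumrB /levnorm lerDl.
by rewrite mulr_ge0// sumr_ge0.
Qed.

Lemma dual_spread_ex n : exists f : dual X, entries f = spread n.
Proof.
have e0 : 0%N \notin (fset0 : {fset nat}) by rewrite inE.
pose e : kalton := exist _ fset0 e0.
have se : spread e = 0.
  apply/funext => k; apply/funext => i.
  by rewrite -[LHS]/(weight #|` val e| k * (i \in fset0)%:R) in_fset0 mulr0.
have := rho_spread n e; rewrite se subr0 => ne.
have D0 : 0 <= dK R n e by rewrite (le_trans _ (prefix_le_dK n e 0)).
have [||f fE _] := @entries_ex R (spread n) (13 * dK R n e + 1).
- by lra.
- by move=> N q; rewrite (le_trans (ne N q))// lerDl.
by exists f.
Qed.

Lemma kalton_lipschitz_embeds : exists f : kalton -> dual X,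
  lipschitz_embedding (@dK R) (fun u v : dual X => `|u - v|) f.
Proof.
have [f fE] := choice dual_spread_ex.
exists f, (1 / 2), 13; split=> // n m; apply/andP; split.
  have h : dK R n m <= 2 * `|f n - f m|.
    apply: dK_le => q; have [N qN] := prefix_spread_le n m q.
    rewrite (le_trans qN)// -!fE -entriesB; exact: rho_entries_le.
  by move: h; lra.
by apply: norm_dual_le => N q; rewrite entriesB !fE; exact: rho_spread.
Qed.

End kalton_embedding.

Theorem theorem5p3 (R : realType) :
  exists X : completeNormedModType R,
    [/\ separable (dual X),
        is_Sz X omega2 &
        exists f : kalton -> dual X,
          lipschitz_embedding (@dK R) (fun u v : dual X => `|u - v|) f].
Proof.
exists (@predual R); split.
- exact: dual_predual_separable.
- exact: is_Sz_predual.
- exact: kalton_lipschitz_embeds.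
Qed.
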